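(* Let $\mathcal{X}=(\mathcal{V},\varrho,\upsilon)$ be a fuzzy graph with $|\mathcal{V}|=n$. Then $$ir_s(\mathcal{X})\le\gamma_s(\mathcal{X})\le\frac{SDI(\mathcal{X})}{n}\le\Gamma_s(\mathcal{X})\le IR_s(\mathcal{X}).$$
   Context: A fuzzy graph $\mathcal{X}=(\mathcal{V},\varrho,\upsilon)$ consists of a nonempty finite set $\mathcal{V}$ of vertices, a function $\varrho:\mathcal{V}\to[0,1]$ and a symmetric function $\upsilon:\mathcal{V}\times\mathcal{V}\to[0,1]$ with $\upsilon(ab)\le\min(\varrho(a),\varrho(b))$ for all $a,b$, and no loops ($\upsilon(aa)=0$). Put $\varrho^*=\{a:\varrho(a)>0\}$ and $\upsilon^*=\{ab:\upsilon(ab)>0\}$; it is assumed that $\mathcal{V}=\varrho^*$, and the elements of $\upsilon^*$ are called edges. A path is a sequence of distinct vertices $a_1,\dots,a_m$ with $\upsilon(a_ia_{i+1})>0$ for all $i<m$; its strength is the minimum of the weights $\upsilon$ of its edges. The strength of connectedness between $a$ and $b$ is the maximum of the strengths of all paths from $a$ to $b$ (and $0$ if there is none). An edge $ab$ is strong if $\upsilon(ab)$ is at least the strength of connectedness between $a$ and $b$ in the fuzzy graph obtained by deleting the edge $ab$. Write $N_s[a]=\{a\}\cup\{b: ab\text{ is a strong edge}\}$. A set $\mathcal{D}\subseteq\mathcal{V}$ is a strong dominating set (SDS) if every $b\in\mathcal{V}\setminus\mathcal{D}$ is joined by a strong edge to some $a\in\mathcal{D}$. An SDS $\mathcal{D}$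 is a minimal strong dominating set (MSDS) if $\mathcal{D}\setminus\{a\}$ is not an SDS for every $a\in\mathcal{D}$. For $a\in\mathcal{S}\subseteq\mathcal{V}$ the private neighborhood is $P_{N_s}[a,\mathcal{S}]=N_s[a]\setminus\bigcup_{b\in\mathcal{S}\setminus\{a\}}N_s[b]$. A set $\mathcal{S}$ is irredundant if $P_{N_s}[a,\mathcal{S}]\ne\emptyset$ for all $a\in\mathcal{S}$, and maximal irredundant if in addition $\mathcal{S}\cup\{a\}$ is not irredundant for every $a\in\mathcal{V}\setminus\mathcal{S}$. The weight of $\mathcal{S}\subseteq\mathcal{V}$ is $W(\mathcal{S})=\sum_{a\in\mathcal{S}}\min\{\upsilon(ab): ab \text{ is a strong edge}\}$; whenever weights are used it is understood that every vertex is incident with at least one strong edge. Then: $ir_s$ is the minimum weight of a maximal irredundant set; $IR_s$ is the maximum weight of an irredundant set; $\gamma_s$ is the minimum weight of an SDS; $\Gamma_s$ is the maximum weight of an MSDS; the strong domination degree ${}_{sd}d(u)$ of a vertex $u$ is the minimum of the weights of the MSDSs containing $u$; the strong domination index is $SDI(\mathcal{X})=\sum_{v\in\mathcal{V}}{}_{sd}d(v)$. *)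

(* Defs.v *)
From mathcomp Require Import all_boot all_order all_algebra.
Set Implicit Arguments.
Unset Strict Implicit.
Unset Printing Implicit Defensive.
Import Order.TTheory GRing.Theory Num.Theory.
Local Open Scope ring_scope.

Section FuzzyGraph.
Variables (R : realFieldType) (V : finType).

Record fuzzyGraph := FuzzyGraph {
  rho : V -> R;
  ups : V -> V -> R;
  fg_nonempty : (0 < #|V|)%N;
  rho_itv : forall a, 0 <= rho a <= 1;
  ups_itv : forall a b, 0 <= ups a b <= 1;
  ups_sym : forall a b, ups a b = ups b a;
  ups_le_min : forall a b, ups a b <= Num.min (rho a) (rho b);
  ups_loopless : forall a, ups a a = 0;
  rho_support : forall a, 0 < rho a
}.

Section DeleteEdge.
Variables (X : fuzzyGraph) (a b : V).

Definition del_ups (x y : V) : R :=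
  if [set x; y] == [set a; b] then 0 else ups X x y.

Fact del_ups_itv x y : 0 <= del_ups x y <= 1.
Proof. by rewrite /del_ups; case: ifP => _; rewrite ?lexx ?ler01 ?ups_itv. Qed.

Fact del_ups_sym x y : del_ups x y = del_ups y x.
Proof. by rewrite /del_ups setUC ups_sym. Qed.

Fact del_ups_le_min x y : del_ups x y <= Num.min (rho X x) (rho X y).
Proof.
rewrite /del_ups; case: ifP => _; last exact: ups_le_min.
by rewrite le_min !ltW ?rho_support.
Qed.

Fact del_ups_loopless x : del_ups x x = 0.
Proof. by rewrite /del_ups ups_loopless; case: ifP. Qed.

Definition del_edge : fuzzyGraph :=
  FuzzyGraph (fg_nonempty X) (rho_itv X) del_ups_itv del_ups_sym
    del_ups_le_min del_ups_loopless (rho_support X).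

End DeleteEdge.

Implicit Types (X : fuzzyGraph) (a b u : V) (S D : {set V}).

Definition edge X a b : bool := 0 < ups X a b.

(* The sequence of vertices a :: p is a path from a to b. *)
Definition fpath_between X a b (p : seq V) : bool :=
  [&& path (edge X) a p, uniq (a :: p) & last a p == b].

(* Edge weights are at most 1, so the unit 1 does not affect the minimum. *)
Definition strength X a (p : seq V) : R :=
  \big[Num.min/1]_(w <- pairmap (ups X) a p) w.

(* Vertices of a path are distinct, so bounding the length of p by #|V|
   excludes no path. *)
Definition conn X a b : R :=
  \big[Num.max/0]_(p : #|V|.-bseq V | fpath_between X a b p) strength X a p.

Definition strong X a b : bool :=
  edge X a b && (conn (del_edge X a b) a b <= ups X a b).

Definition Ns X a : {set V} := a |: [set b | strong X a b].

Definition SDS X D : bool :=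
  [forall b in ~: D, exists a in D, strong X a b].

Definition MSDS X D : bool :=
  SDS X D && [forall a in D, ~~ SDS X (D :\ a)].

Definition private_nbhd X a S : {set V} :=
  Ns X a :\: \bigcup_(b in S :\ a) Ns X b.

Definition irredundant X S : bool :=
  [forall a in S, private_nbhd X a S != set0].

Definition max_irredundant X S : bool :=
  irredundant X S && [forall a in ~: S, ~~ irredundant X (a |: S)].

(* As for strength, the unit 1 is harmless as soon as a is incident with a
   strong edge. *)
Definition vweight X a : R := \big[Num.min/1]_(b | strong X a b) ups X a b.

Definition weight X S : R := \sum_(a in S) vweight X a.

(* Vertex weights are nonnegative, so 0 <= weight X S <= weight X setT for all
   S: the units below do not affect the extrema over a nonempty family P. *)
Definition min_weight X (P : pred {set V}) : R :=
  \big[Num.min/weight X setT]_(S | P S) weight X S.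

Definition max_weight X (P : pred {set V}) : R :=
  \big[Num.max/0]_(S | P S) weight X S.

Definition ir_s X : R := min_weight X (max_irredundant X).
Definition IR_s X : R := max_weight X (irredundant X).
Definition gamma_s X : R := min_weight X (SDS X).
Definition Gamma_s X : R := max_weight X (MSDS X).

Definition sd_degree X u : R := min_weight X [pred D | MSDS X D && (u \in D)].

Definition SDI X : R := \sum_(v : V) sd_degree X v.

End FuzzyGraph.

(* Main.v *)
(** Strong adjacency is a symmetric relation, since reversing a path preserves
    its strength; so the classical domination chain of graphs applies. A minimal
    dominating set is irredundant, and adding a vertex to a dominating set always
    destroys irredundance. Every dominating set contains a minimal one, of no
    larger weight, and every vertex [u] lies in a minimal one, namely any maximal
    independent set containing [u]. Hence [gamma_s <= sd_degree u <= Gamma_s] for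
    every [u], and one averages over [u]. *)
Require Import Defs.
From mathcomp Require Import all_boot all_order all_algebra.
Set Implicit Arguments.
Unset Strict Implicit.
Unset Printing Implicit Defensive.
Import Order.TTheory GRing.Theory Num.Theory.
Local Open Scope ring_scope.

(** Thresholds turn a minimum over edges into a [path] predicate, to which [rev_path] applies;
    [t <= 1] accounts for the unit of the minimum. *)
Lemma le_strength (R : realFieldType) (V : finType) (X : fuzzyGraph R V)
    (t : R) a p :
  (t <= strength X a p) = (t <= 1) && path (fun x y => t <= ups X x y) a p.
Proof.
rewrite /strength; elim: p a => [|b p IHp] a /=; first by rewrite big_nil andbT.
by rewrite big_cons le_min IHp andbCA.
Qed.

(** Two graphs are allowed because [strong_sym] compares [del_edge X d c] with [del_edge X c d],
    which are distinct terms. *)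
Lemma conn_rev_le (R : realFieldType) (V : finType) (X Y : fuzzyGraph R V) a b :
  (forall x y, ups X x y = ups Y y x) -> conn X a b <= conn Y b a.
Proof.
move=> eqXY; apply/bigmax_leP; split=> [|p /and3P[pathp uniqp /eqP lastp]].
  exact: bigmax_ge_id.
(* The witness is the reversed path: started at [b], its tail is [rev (belast a p)]. *)
have revE : b :: rev (belast a p) = rev (a :: p).
  by rewrite (lastI a) lastp rev_rcons.
have size_q : (size (rev (belast a p)) <= #|V|)%N.
  by rewrite size_rev size_belast size_bseq.
have le_pq : strength X a p <= strength Y b (rev (belast a p)).
  have := lexx (strength X a p); rewrite !le_strength.
  case/andP=> -> /=; rewrite -lastp rev_path.
  by apply: sub_path => x y /=; rewrite eqXY.
apply: le_trans le_pq _.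
apply: (le_bigmax_cond _ (P := fun q : #|V|.-bseq V => fpath_between Y b a q)
  (j := Bseq size_q)).
apply/and3P; split.
- rewrite /= -lastp rev_path; apply: sub_path pathp => x y.
  by rewrite /edge eqXY.
- by rewrite -rev_uniq -revE in uniqp.
- by rewrite -[last b _]/(last a (b :: _)) revE rev_cons last_rcons.
Qed.

Lemma strong_sym (R : realFieldType) (V : finType) (X : fuzzyGraph R V) a b :
  strong X a b = strong X b a.
Proof.
suff imp c d : strong X c d -> strong X d c by apply/idP/idP; apply: imp.
rewrite /strong /edge (ups_sym X d c) => /andP[-> le_conn] /=.
apply: le_trans le_conn; apply: conn_rev_le => x y /=.
by rewrite /del_ups (setUC [set d]) (setUC [set x]) ups_sym.
Qed.

Lemma strong_irrefl (R : realFieldType) (V : finType) (X : fuzzyGraph R V) a :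
  strong X a a = false.
Proof. by rewrite /strong /edge ups_loopless ltxx. Qed.

Section Domination.
Variables (R : realFieldType) (V : finType) (X : fuzzyGraph R V).
Implicit Types (a b u : V) (S D : {set V}).

Lemma in_Ns a b : (b \in Ns X a) = (b == a) || strong X a b.
Proof. by rewrite !inE. Qed.

(** With closed neighborhoods, members of [D] dominate themselves and need no separate case. *)
Lemma SDSP D :
  reflect (forall b, exists2 a, a \in D & b \in Ns X a) (SDS X D).
Proof.
apply: (iffP forall_inP) => [domD b | domD b].
  have [bD | bND] := boolP (b \in D); first by exists b; rewrite ?in_Ns ?eqxx.
  have /exists_inP[a aD sab] := domD b ltac:(by rewrite inE).
  by exists a; rewrite ?in_Ns ?sab ?orbT.
rewrite inE => bND; have [a aD] := domD b; rewrite in_Ns => /predU1P[ba | sab].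
  by rewrite ba aD in bND.
by apply/exists_inP; exists a.
Qed.

Lemma SDS_mono D S : D \subset S -> SDS X D -> SDS X S.
Proof.
move=> /subsetP sDS /SDSP domD; apply/SDSP => b.
by have [a /sDS] := domD b; exists a.
Qed.

Lemma SDS_setT : SDS X setT.
Proof. by apply/SDSP => b; exists b; rewrite ?in_Ns ?eqxx. Qed.

Lemma MSDS_exists S : SDS X S -> exists2 D, MSDS X D & D \subset S.
Proof.
move=> /minset_exists[D /minsetP[domD minD] sDS]; exists D => //.
apply/andP; split=> //; apply/forall_inP => a aD; apply/negP => domDa.
by have := minD _ domDa (subsetDl _ _); move/setP/(_ a); rewrite !inE eqxx aD.
Qed.

(** If [a] has no private neighbor, all that it dominates is dominated by other members of [D], so
    [D :\ a] still dominates. *)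
Lemma MSDS_irredundant D : MSDS X D -> irredundant X D.
Proof.
case/andP=> /SDSP domD /forall_inP minD; apply/forall_inP => a aD.
apply: contra (minD a aD) => /eqP priv0; apply/SDSP => b.
have [c cD bNc] := domD b; have [ca | neq_ca] := eqVneq c a; last first.
  by exists c; rewrite // !inE neq_ca.
have : b \notin private_nbhd X a D by rewrite priv0 inE.
rewrite inE -ca bNc andbT negbK => /bigcupP[d dD bNd].
by exists d => //; rewrite -ca.
Qed.

(** The closed neighborhoods of [D] already cover all vertices, which leaves nothing private to
    [a]. *)
Lemma SDS_not_irredundant D a : SDS X D -> a \notin D -> ~~ irredundant X (a |: D).
Proof.
move=> /SDSP domD aND; apply/forall_inPn; exists a; first exact: setU11.
rewrite negbK setD_eq0 setU1K //; apply/subsetP => b _.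
by have [c cD bNc] := domD b; apply/bigcupP; exists c.
Qed.

Lemma MSDS_max_irredundant D : MSDS X D -> max_irredundant X D.
Proof.
move=> minD; rewrite /max_irredundant MSDS_irredundant //=.
apply/forall_inP => a; rewrite inE; apply: SDS_not_irredundant.
by case/andP: minD.
Qed.

Lemma MSDS_containing u : exists2 D, MSDS X D & u \in D.
Proof.
pose indep S := [forall a in S, forall b in S, ~~ strong X a b].
have indepu : indep [set u].
  apply/forall_inP => a /set1P->; apply/forall_inP => b /set1P->.
  by rewrite strong_irrefl.
have [D /maxsetP[/forall_inP indD maxD]] := maxset_exists indepu.
rewrite sub1set => uD; exists D => //.
have indepP a b : a \in D -> b \in D -> strong X a b = false.
  by move=> /indD /forall_inP h /h /negPf.
apply/andP; split; apply/forall_inP => a aD.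
  (* Domination: a vertex without strong neighbor in [D] could be added to [D], against
     maximality. *)
  rewrite inE in aD; apply/contraT => /exists_inPn nostrong.
  suff /maxD/(_ (subsetUr _ _)) eqD : indep (a |: D) by rewrite -eqD setU11 in aD.
  apply/forall_inP => b /setU1P bD; apply/forall_inP => c /setU1P cD.
  case: bD cD => [->|bD] [->|cD].
  - by rewrite strong_irrefl.
  - by rewrite strong_sym nostrong.
  - exact: nostrong.
  - by rewrite indepP.
(* Minimality: once removed, [a] would need a strong neighbor in [D], against independence. *)
apply/negP => /SDSP/(_ a)[b]; rewrite !inE => /andP[neq_ba bD].
by rewrite eq_sym (negPf neq_ba) indepP.
Qed.

Lemma vweight_ge0 a : 0 <= vweight X a.
Proof.
apply/bigmin_geP; split=> // b _.
by case/andP: (ups_itv X a b).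
Qed.

Lemma weight_mono S D : S \subset D -> weight X S <= weight X D.
Proof.
move=> sSD; rewrite /weight [leRHS](big_setID S) /= (setIidPr sSD) lerDl.
by apply: sumr_ge0 => a _; apply: vweight_ge0.
Qed.

Lemma min_weight_le (P : pred {set V}) S : P S -> min_weight X P <= weight X S.
Proof. exact: bigmin_le_cond. Qed.

Lemma max_weight_ge (P : pred {set V}) S : P S -> weight X S <= max_weight X P.
Proof. exact: le_bigmax_cond. Qed.

Lemma le_min_weight (P Q : pred {set V}) :
  (forall S, Q S -> exists2 D, P D & D \subset S) ->
  min_weight X P <= min_weight X Q.
Proof.
(* The first goal concerns the default [weight X setT], shared by both minima. *)
move=> PQ; apply/bigmin_geP; split=> [|S /PQ[D PD sDS]].
  exact: bigmin_le_id.
by apply: le_trans (weight_mono sDS); apply: min_weight_le.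
Qed.

Lemma le_max_weight (P Q : pred {set V}) :
  (forall S, P S -> Q S) -> max_weight X P <= max_weight X Q.
Proof.
move=> PQ; apply/bigmax_leP; split=> [|S /PQ]; first exact: bigmax_ge_id.
exact: max_weight_ge.
Qed.

Lemma gamma_s_le_sd_degree u : gamma_s X <= sd_degree X u.
Proof. by apply: le_min_weight => S /andP[/andP[domS _] _]; exists S. Qed.

Lemma sd_degree_le_Gamma_s u : sd_degree X u <= Gamma_s X.
Proof.
have [D minD uD] := MSDS_containing u.
apply: le_trans (max_weight_ge minD).
by apply: min_weight_le; rewrite /= minD.
Qed.

End Domination.

Theorem proposition4p4 (R : realFieldType) (V : finType) (n : nat)
    (X : fuzzyGraph R V) (cardV : #|V| = n)
    (strong_incident : forall a : V, exists b : V, strong X a b) :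
  [/\ ir_s X <= gamma_s X,
      gamma_s X <= SDI X / n%:R,
      SDI X / n%:R <= Gamma_s X
    & Gamma_s X <= IR_s X].
Proof.
have n_gt0 : 0 < n%:R :> R by rewrite ltr0n -cardV (fg_nonempty X).
(* Writing [c * n%:R] as a constant sum reduces both averaging bounds to termwise comparisons. *)
have sum_const (c : R) : \sum_(v : V) c = c * n%:R.
  by rewrite sumr_const cardV mulr_natr.
split.
- apply: le_min_weight => S /MSDS_exists[D minD sDS].
  by exists D => //; apply: MSDS_max_irredundant.
- rewrite ler_pdivlMr // -sum_const; apply: ler_sum => u _.
  exact: gamma_s_le_sd_degree.
- rewrite ler_pdivrMr // -sum_const; apply: ler_sum => u _.
  exact: sd_degree_le_Gamma_s.
- by apply: le_max_weight => S; apply: MSDS_irredundant.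
Qed.
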